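(* Let $A\in\mathbb C^{M\times M}$ be a stable matrix (all eigenvalues lie in the open left half-plane) and let $\lambda_k$, $k=1,2,\dots,M$, be the eigenvalues of $A$ (counted with algebraic multiplicity). Let $\tau>0$, $\alpha>-1$, and let $N$ be a natural number. Then $$\sqrt{\max_{k}\zeta(N,\tau,\alpha,\lambda_k)}\le\lVert H_{A}-H_{N,\tau,\alpha,A}\rVert_{L_2[0,\infty)},$$ and, provided that $A$ is diagonalizable, $A=TDT^{-1}$ with $T\in\mathbb C^{M\times M}$ invertible and $D\in\mathbb C^{M\times M}$ diagonal, $$\lVert H_{A}-H_{N,\tau,\alpha,A}\rVert_{L_2[0,\infty)}\le\varkappa(T)\sqrt{\sum_{k=1}^{M}\zeta(N,\tau,\alpha,\lambda_k)}\le\varkappa(T)\sqrt{M\max_{k}\zeta(N,\tau,\alpha,\lambda_k)},$$ where $\varkappa(T)=\lVert T\rVert_{2\to2}\cdot\lVert T^{-1}\rVert_{2\to2}$ is the condition number of $T$.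
   Context: Generalized Laguerre polynomials: for $\alpha>-1$ and $n=0,1,\dots$, $$L_n^\alpha(t)=\frac{t^{-\alpha}e^t}{n!}\frac{d^n}{dt^n}\bigl(t^{n+\alpha}e^{-t}\bigr)=\sum_{k=0}^n(-1)^k\binom{n+\alpha}{n-k}\frac{t^k}{k!}.$$ Laguerre functions: for $\tau>0$, $\alpha>-1$, $n=0,1,\dots$, $$l_{n,\tau}^\alpha(t)=\sqrt{\frac{n!}{\Gamma(n+\alpha+1)}}\,\tau^{\frac{\alpha+1}{2}}\,t^{\frac{\alpha}{2}}\,e^{-\tau t/2}L_n^\alpha(\tau t).$$ They form an orthonormal basis in $L_2[0,\infty)$. For a stable matrix $A\in\mathbb C^{M\times M}$: $H_A(t)=e^{At}$, $t>0$; $S_{n,\tau,\alpha,A}=\int_0^\infty e^{At}\,l_{n,\tau}^\alpha(t)\,dt\in\mathbb C^{M\times M}$; and $H_{N,\tau,\alpha,A}(t)=\sum_{n=0}^N S_{n,\tau,\alpha,A}\,l_{n,\tau}^\alpha(t)$. For $\lambda\in\mathbb C$ with $\operatorname{Re}\lambda<0$: $s_{n,\tau,\alpha,\lambda}=\int_0^\infty e^{\lambda t}\,l_{n,\tau}^\alpha(t)\,dt$ and $$\zeta(N,\tau,\alpha,\lambda)=\int_0^\infty\Bigl\lvert e^{\lambda t}-\sum_{n=0}^{N}s_{n,\tau,\alpha,\lambda}\,l_{n,\tau}^\alpha(t)\Bigr\rvert^2\,dt.$$ Norms: $\lVert\cdot\rVert_{2\to2}$ is the matrix norm induced by the Euclidean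 norm on $\mathbb C^M$, $\lVert C\rVert_F=\sqrt{\sum_{i,j}|C_{ij}|^2}$ is the Frobenius norm, and $$\lVert H_A-H_{N,\tau,\alpha,A}\rVert_{L_2[0,\infty)}=\sqrt{\int_0^\infty\lVert H_A(t)-H_{N,\tau,\alpha,A}(t)\rVert_F^2\,dt}.$$ *)

(* Defs.v *)
From HB Require Import structures.
From mathcomp Require Import all_boot all_order all_algebra.
From mathcomp Require Import all_classical all_reals all_analysis.
From mathcomp.real_closed Require Import complex.

Set Implicit Arguments.
Unset Strict Implicit.
Unset Printing Implicit Defensive.

Import Order.TTheory GRing.Theory Num.Theory numFieldNormedType.Exports.

Local Open Scope classical_set_scope.
Local Open Scope ring_scope.
Local Open Scope complex_scope.

(* Euler's integral, meaningful for 0 < a only *)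
Definition Gamma (R : realType) (a : R) : R :=
  \int[lebesgue_measure]_(x in `]0, +oo[) (x `^ (a - 1) * expR (- x)).

(* binom(x, k) for a real upper argument x *)
Definition gbinom (R : realType) (x : R) (k : nat) : R :=
  (\prod_(i < k) (x - i%:R)) / k`!%:R.

Definition laguerre_poly (R : realType) (alpha : R) (n : nat) (t : R) : R :=
  \sum_(k < n.+1)
     (-1) ^+ k * gbinom (n%:R + alpha) (n - k)%N * (t ^+ k / k`!%:R).

(* At t = 0 the library's conventions 0 `^ 0 = 1 and 0 `^ r = 0 (r != 0) apply;
   this point is negligible in all the integrals below. *)
Definition laguerre_fun (R : realType) (tau alpha : R) (n : nat) (t : R) : R :=
  Num.sqrt (n`!%:R / Gamma (n%:R + alpha + 1)) * tau `^ ((alpha + 1) / 2)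
  * t `^ (alpha / 2) * expR (- (tau * t / 2))
  * laguerre_poly alpha n (tau * t).

Definition cintegral (R : realType) (f : R -> R[i]) : R[i] :=
  (\int[lebesgue_measure]_(t in `[0, +oo[) complex.Re (f t)) +i*
  (\int[lebesgue_measure]_(t in `[0, +oo[) complex.Im (f t)).

Definition cexp (R : realType) (z : R[i]) : R[i] :=
  (expR (complex.Re z) * cos (complex.Im z)) +i*
  (expR (complex.Re z) * sin (complex.Im z)).

(* The limit is taken in the normed module of M x M complex matrices. *)
Definition mexp (R : realType) (M : nat) (A : 'M[R[i]]_M) : 'M[R[i]]_M :=
  limn (series (fun k => k`!%:R^-1 *: A ^+ k)).

Definition euclid_norm (R : realType) (M : nat) (x : 'cV[R[i]]_M) : R :=
  Num.sqrt (\sum_(i < M) Normc.normc (x i 0) ^+ 2).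

Definition op_norm (R : realType) (M : nat) (T : 'M[R[i]]_M) : R :=
  sup [set euclid_norm (T *m x) |
        x in [set x : 'cV[R[i]]_M | euclid_norm x <= 1]].

Definition frobenius_norm (R : realType) (M : nat) (C : 'M[R[i]]_M) : R :=
  Num.sqrt (\sum_(i < M) \sum_(j < M) Normc.normc (C i j) ^+ 2).

Definition cond_num (R : realType) (M : nat) (T : 'M[R[i]]_M) : R :=
  op_norm T * op_norm (invmx T).

(* Valued in \bar R, so that a non-square-integrable F has norm +oo. *)
Definition L2_norm (R : realType) (M : nat) (F : R -> 'M[R[i]]_M) : \bar R :=
  sqrte (\int[lebesgue_measure]_(t in `[0%R, +oo[)
           ((frobenius_norm (F t)) ^+ 2)%:E)%E.

Definition stable_mx (R : realType) (M : nat) (A : 'M[R[i]]_M) : Prop :=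
  forall a : R[i], eigenvalue A a -> complex.Re a < 0.

Definition H_mx (R : realType) (M : nat) (A : 'M[R[i]]_M) (t : R) :
    'M[R[i]]_M :=
  mexp (t%:C *: A).

Definition S_mx (R : realType) (M : nat) (n : nat) (tau alpha : R)
    (A : 'M[R[i]]_M) : 'M[R[i]]_M :=
  \matrix_(i < M, j < M)
     cintegral (fun t => H_mx A t i j * (laguerre_fun tau alpha n t)%:C).

Definition HN_mx (R : realType) (M : nat) (N : nat) (tau alpha : R)
    (A : 'M[R[i]]_M) (t : R) : 'M[R[i]]_M :=
  \sum_(n < N.+1) (laguerre_fun tau alpha n t)%:C *: S_mx n tau alpha A.

Definition s_coef (R : realType) (n : nat) (tau alpha : R) (lambda : R[i]) :
    R[i] :=
  cintegral (fun t => cexp (lambda * t%:C) * (laguerre_fun tau alpha n t)%:C).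

Definition zeta (R : realType) (N : nat) (tau alpha : R) (lambda : R[i]) :
    \bar R :=
  (\int[lebesgue_measure]_(t in `[0%R, +oo[)
     ((Normc.normc (cexp (lambda * t%:C) -
        \sum_(n < N.+1)
           s_coef n tau alpha lambda * (laguerre_fun tau alpha n t)%:C)%R)
      ^+ 2)%:E)%E.

(* Main.v *)
(* The error at time t is E(t) = H_A(t) - H_{N,A}(t).  If A v = z v then
   e^{At} v = e^{zt} v, hence S_n v = s_n(z) v and E(t) v = d_z(t) v, where d_z
   is the error of the scalar function e^{zt}, so that zeta(z) is the integral
   of |d_z|^2.  Any eigenvector gives |d_z(t)| <= ||E(t)||_F, and integrating
   yields the lower bound.  If A = T D T^-1, the columns of T are eigenvectors,
   so E(t) = T diag(d_k(t)) T^-1 and ||E(t)||_F^2 <= kappa(T)^2 sum_k |d_k(t)|^2,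
   whose integral is the upper bound.

   Moving v inside the integral defining S_n requires the entries of
   e^{At} l_n(t) to be integrable.  The Laguerre functions are integrable, being
   dominated by t^(alpha/2) e^{-tau t/4}, and e^{At} is bounded for t >= 0 by
   Cayley-Hamilton: e^{At} prod_k (A - lambda_k) = 0, and the factors are removed
   one at a time, since F = e^{At} B solves F' = z F + e^{At} (A - z) B and a
   bounded forcing term gives a bounded solution when Re z < 0. *)
Require Import Defs.
From HB Require Import structures.
From mathcomp Require Import all_boot all_order all_algebra.
From mathcomp Require Import all_classical all_reals all_analysis.
From mathcomp Require Import measurable_realfun ring lra.
From mathcomp.real_closed Require Import complex.
Import Order.TTheory GRing.Theory Num.Theory numFieldNormedType.Exports.
Local Open Scope classical_set_scope.
Local Open Scope ring_scope.

Set Implicit Arguments.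
Unset Strict Implicit.
Unset Printing Implicit Defensive.

Local Open Scope complex_scope.
Local Notation Re := (@complex.Re _).
Local Notation Im := (@complex.Im _).

(** * Complex-valued functions of a real variable *)

Lemma ReD (R : realType) (x y : R[i]) :
  Re (x + y) = Re x + Re y.
Proof. by case: x y => [a b] [c d]. Qed.

Lemma ImD (R : realType) (x y : R[i]) :
  Im (x + y) = Im x + Im y.
Proof. by case: x y => [a b] [c d]. Qed.

Lemma ReM (R : realType) (x y : R[i]) :
  Re (x * y) = Re x * Re y - Im x * Im y.
Proof. by case: x y => [a b] [c d]. Qed.

Lemma ImM (R : realType) (x y : R[i]) :
  Im (x * y) = Re x * Im y + Im x * Re y.
Proof. by case: x y => [a b] [c d]. Qed.

Lemma complex_eqP (R : realType) (x y : R[i]) :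
  Re x = Re y -> Im x = Im y -> x = y.
Proof. by case: x y => [a b] [c d] /= -> ->. Qed.

Lemma normc_sqr (R : realType) (x : R[i]) :
  Normc.normc x ^+ 2 = Re x ^+ 2 + Im x ^+ 2.
Proof. by case: x => a b /=; rewrite sqr_sqrtr// addr_ge0// sqr_ge0. Qed.

Lemma normc_ge0 (R : realType) (x : R[i]) : 0 <= Normc.normc x.
Proof. by case: x => a b; exact: sqrtr_ge0. Qed.

Lemma ler_Re_normc (R : realType) (x : R[i]) : `|Re x| <= Normc.normc x.
Proof.
rewrite -(ler_pXn2r (ltn0Sn 1)) ?nnegrE ?normc_ge0//.
by rewrite normc_sqr real_normK ?num_real// lerDl sqr_ge0.
Qed.

Lemma ler_Im_normc (R : realType) (x : R[i]) : `|Im x| <= Normc.normc x.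
Proof.
rewrite -(ler_pXn2r (ltn0Sn 1)) ?nnegrE ?normc_ge0//.
by rewrite normc_sqr real_normK ?num_real// lerDr sqr_ge0.
Qed.

Lemma ler_normc_ReIm (R : realType) (x : R[i]) :
  Normc.normc x <= `|Re x| + `|Im x|.
Proof.
rewrite -(ler_pXn2r (ltn0Sn 1)) ?nnegrE ?normc_ge0 ?addr_ge0//.
rewrite normc_sqr sqrrD !real_normK ?num_real//.
by rewrite lerD2r lerDl mulrn_wge0// mulr_ge0.
Qed.

Lemma normc_sum (R : realType) (I : Type) (s : seq I) (F : I -> R[i]) :
  Normc.normc (\sum_(i <- s) F i) <= \sum_(i <- s) Normc.normc (F i).
Proof.
elim/big_ind2 : _ => [|x a y b xa yb|//]; first by rewrite Normc.normc0.
by rewrite (le_trans (le_normcD _ _))// lerD.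
Qed.

(** Differentiation is componentwise, so that real results on monotone and constant functions apply
    to each part. *)
Definition cderiv (R : realType) (f f' : R -> R[i]) := forall t : R,
  is_derive t 1 (Re \o f) (Re (f' t)) /\
  is_derive t 1 (Im \o f) (Im (f' t)).

Lemma cderivD (R : realType) (f f' g g' : R -> R[i]) :
  cderiv f f' -> cderiv g g' -> cderiv (fun t => f t + g t) (fun t => f' t + g' t).
Proof.
move=> df dg t; have [[fr fi] [gr gi]] := (df t, dg t).
have -> : Re \o (fun s => f s + g s) = (Re \o f : R -> R) + (Re \o g).
  by apply/funext => s /=; rewrite ReD.
have -> : Im \o (fun s => f s + g s) = (Im \o f : R -> R) + (Im \o g).
  by apply/funext => s /=; rewrite ImD.
by rewrite ReD ImD; split; exact: is_deriveD.
Qed.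

Lemma cderivM (R : realType) (f f' g g' : R -> R[i]) :
  cderiv f f' -> cderiv g g' ->
  cderiv (fun t => f t * g t) (fun t => f' t * g t + f t * g' t).
Proof.
move=> df dg t; have [[fr fi] [gr gi]] := (df t, dg t).
have dM (u v : R -> R) a b : is_derive t 1 u a -> is_derive t 1 v b ->
    is_derive t (1 : R) (u * v) (a * v t + u t * b).
  move=> du dv; apply: (@is_derive_eq _ _ _ _ _ _ _ _ (is_deriveM du dv)).
  by rewrite /GRing.scale/= addrC mulrC.
have -> : Re \o (fun s => f s * g s) =
    ((Re \o f : R -> R) * (Re \o g)) - (Im \o f : R -> R) * (Im \o g).
  by apply/funext => s /=; rewrite ReM.
have -> : Im \o (fun s => f s * g s) =
    ((Re \o f : R -> R) * (Im \o g)) + (Im \o f : R -> R) * (Re \o g).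
  by apply/funext => s /=; rewrite ImM.
split.
  have d1 := dM _ _ _ _ fr gr; have d2 := dM _ _ _ _ fi gi.
  apply: (@is_derive_eq _ _ _ _ _ _ _ _ (is_deriveB d1 d2)).
  by rewrite /= ReD !ReM; ring.
have d1 := dM _ _ _ _ fr gi; have d2 := dM _ _ _ _ fi gr.
apply: (@is_derive_eq _ _ _ _ _ _ _ _ (is_deriveD d1 d2)).
by rewrite /= ImD !ImM; ring.
Qed.

Lemma cderiv_cst (R : realType) (c : R[i]) : cderiv (fun=> c) (fun=> 0).
Proof. by move=> t; split; exact: is_derive_cst. Qed.

Lemma cderiv_ext (R : realType) (f g f' g' : R -> R[i]) :
  f =1 g -> f' =1 g' -> cderiv f f' -> cderiv g g'.
Proof. by move=> /funext -> /funext ->. Qed.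

Lemma cderiv_sum (R : realType) (I : Type) (s : seq I) (f f' : I -> R -> R[i]) :
  (forall i, cderiv (f i) (f' i)) ->
  cderiv (fun t => \sum_(i <- s) f i t) (fun t => \sum_(i <- s) f' i t).
Proof.
move=> df; elim: s => [|i s ih].
  by apply: cderiv_ext (cderiv_cst 0) => t; rewrite big_nil.
by apply: cderiv_ext (cderivD (df i) ih) => t; rewrite big_cons.
Qed.

Lemma cderiv_cexp (R : realType) (z : R[i]) :
  cderiv (fun t : R => cexp (z * t%:C)) (fun t => z * cexp (z * t%:C)).
Proof.
move=> t.
have E : (fun t : R => cexp (z * t%:C)) = fun t : R =>
   (expR (Re z * t) * cos (Im z * t)) +i*
   (expR (Re z * t) * sin (Im z * t)).
  by apply/funext => s; rewrite /cexp ReM ImM /= !mulr0 subr0 add0r.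
rewrite {}E; case: z => a b /=.
have da c : is_derive t (1 : R) (fun s : R => c * s) c.
  rewrite -[X in is_derive _ _ _ X]mulr1.
  exact: (@is_deriveZ _ _ _ id c t 1 1).
have de := is_derive1_comp (is_derive_expR (a * t)) (da a).
have dc := is_derive1_comp (is_derive_cos (b * t)) (da b).
have ds := is_derive1_comp (is_derive_sin (b * t)) (da b).
split.
  apply: (@is_derive_eq _ _ _ _ _ _ _ _ (is_deriveM de dc)).
  rewrite /GRing.scale/= !mulr0 !subr0 add0r; ring.
apply: (@is_derive_eq _ _ _ _ _ _ _ _ (is_deriveM de ds)).
rewrite /GRing.scale/= !mulr0 !subr0 add0r; ring.
Qed.

(** * The matrix exponential as an entrywise power series *)

Definition ccvg (R : realType) (u : nat -> R[i]) (l : R[i]) :=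
  (Re (u n) @[n --> \oo] --> Re l) /\ (Im (u n) @[n --> \oo] --> Im l).

Lemma ccvg_unique (R : realType) (u : nat -> R[i]) (l l' : R[i]) :
  ccvg u l -> ccvg u l' -> l = l'.
Proof.
by move=> [ur ui] [ur' ui']; apply: complex_eqP; [exact: cvg_unique ur ur'|
  exact: cvg_unique ui ui'].
Qed.

Lemma ccvgD (R : realType) (u v : nat -> R[i]) (l m : R[i]) :
  ccvg u l -> ccvg v m -> ccvg (fun n => u n + v n) (l + m).
Proof.
move=> [ur ui] [vr vi]; split; rewrite ?ReD ?ImD.
  by under eq_fun do rewrite ReD; exact: cvgD.
by under eq_fun do rewrite ImD; exact: cvgD.
Qed.

Lemma ccvgMr (R : realType) (u : nat -> R[i]) (l c : R[i]) :
  ccvg u l -> ccvg (fun n => u n * c) (l * c).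
Proof.
move=> [ur ui]; split; rewrite ?ReM ?ImM.
  by under eq_fun do rewrite ReM; apply: cvgB; exact: cvgMl.
by under eq_fun do rewrite ImM; apply: cvgD; exact: cvgMl.
Qed.

Lemma ccvg_sum (R : realType) (I : Type) (s : seq I) (u : I -> nat -> R[i])
    (l : I -> R[i]) :
  (forall i, ccvg (u i) (l i)) ->
  ccvg (fun n => \sum_(i <- s) u i n) (\sum_(i <- s) l i).
Proof.
move=> ul; elim: s => [|i s ih].
  rewrite big_nil; under eq_fun do rewrite big_nil.
  by split; exact: cvg_cst.
rewrite big_cons; under eq_fun do rewrite big_cons.
exact: ccvgD.
Qed.

(** Balls of the normed module of matrices are entrywise, so convergence of the real and imaginary
    parts of all entries determines the limit. *)
Lemma limn_ccvg_mx (R : realType) (m n : nat)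
    (u : nat -> ('M[R[i]]_(m, n) : normedModType R[i])) (L : 'M[R[i]]_(m, n)) :
  (forall i j, ccvg (fun k => u k i j) (L i j)) -> limn u = L.
Proof.
move=> uL; apply: cvg_lim; first exact: norm_hausdorff.
apply/cvg_ballP => eps eps0.
(* The radius is a positive element of [R[i]], and comparability with 0 forces its imaginary part to
   vanish. *)
have [e e0 ->] : exists2 e : R, 0 < e & eps = e%:C.
  move: eps0; case: eps => a b; rewrite ltcE /= => /andP[/eqP -> a0].
  by exists a.
have e20 : 0 < e / 2 by rewrite divr_gt0.
(* There are finitely many entries, so one rank serves them all; each of the two parts takes half of
   the radius. *)
have : \forall k \near \oo, forall ij : 'I_m * 'I_n,
    `|Re (L ij.1 ij.2) - Re (u k ij.1 ij.2)| < e / 2 /\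
    `|Im (L ij.1 ij.2) - Im (u k ij.1 ij.2)| < e / 2.
  apply: filter_forall => -[i j] /=; have [ur ui] := uL i j.
  near=> k; split; near: k.
    by move/cvgrPdist_lt : ur; exact.
  by move/cvgrPdist_lt : ui; exact.
apply: filterS => k uk; split; first by rewrite ltcR.
move=> i j; have [] := uk (i, j) => /= hr hi.
rewrite /ball/= /Num.norm/= ltcR (le_lt_trans (ler_normc_ReIm _))//.
rewrite (splitr e) ltrD//.
  by case: (L i j) (u k i j) hr hi => a b [c d].
by case: (L i j) (u k i j) hr hi => a b [c d].
Unshelve. all: by end_near. Qed.

(** With K the sum of the moduli of all entries, every column sum of moduli is at most K, and each
    further factor A costs at most a factor K. *)
Lemma normc_expmx_le (R : realType) (M : nat) (A : 'M[R[i]]_M) :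
  exists2 K : R, 0 <= K & forall k i j, Normc.normc ((A ^+ k) i j) <= K ^+ k.
Proof.
pose K := \sum_i \sum_j Normc.normc (A i j).
have K0 : 0 <= K by do 2!apply: sumr_ge0 => ? _; exact: normc_ge0.
have AK j : \sum_l Normc.normc (A l j) <= K.
  apply: ler_sum => l _; rewrite (bigD1 j)//= lerDl.
  by apply: sumr_ge0 => ? _; exact: normc_ge0.
exists K => // ; elim=> [|k ih] i j.
  rewrite !expr0 mxE; case: (i == j) => /=.
    by rewrite [leLHS](Normc.normc1 R).
  by rewrite [leLHS](Normc.normc0 R).
rewrite exprSr -mulmxE mxE (le_trans (normc_sum _ _))//.
rewrite (@le_trans _ _ (\sum_l K ^+ k * Normc.normc (A l j)))//.
  by apply: ler_sum => l _; rewrite Normc.normcM ler_wpM2r// normc_ge0.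
by rewrite -mulr_sumr exprSr ler_wpM2l// exprn_ge0.
Qed.

(* With p = Re or Im: the Taylor coefficients at 0 of the m-th derivative of
   t |-> p ((exp (t A)) i j). *)
Definition expmx_coef (R : realType) (M : nat) (p : R[i] -> R) (A : 'M[R[i]]_M)
  (i j : 'I_M) (m k : nat) : R := p ((A ^+ (m + k)) i j) / k`!%:R.

(** Entries of [A ^+ k] are at most K^k in modulus, so the series is dominated by K^m times the
    exponential series at K |t|. *)
Lemma is_cvg_expmx_coef (R : realType) (M : nat) (p : R[i] -> R)
    (A : 'M[R[i]]_M) i j m t :
  (forall z, `|p z| <= Normc.normc z) -> cvgn (pseries (expmx_coef p A i j m) t).
Proof.
move=> pn; have [K K0 AK] := normc_expmx_le A.
apply: normed_cvg; apply: (@series_le_cvg _ _ (K ^+ m *: exp_coeff (K * `|t|))).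
- by move=> n; exact: normr_ge0.
- by move=> n; rewrite mulr_ge0 ?exprn_ge0// exp_coeff_ge0// mulr_ge0.
- move=> n; rewrite -[leRHS]/(K ^+ m * ((K * `|t|) ^+ n / n`!%:R)) /= /expmx_coef.
  rewrite normrM normrM normrX normfV (@ger0_norm _ n`!%:R)// exprMn.
  rewrite [leRHS]mulrA mulrAC ler_wpM2r ?invr_ge0// mulrA ler_wpM2r ?exprn_ge0//.
  by rewrite -exprD; exact: le_trans (pn _) (AK _ _ _).
- by apply: is_cvg_seriesZ; exact: is_cvg_series_exp_coeff.
Qed.

(** Since (k+1) / (k+1)! = 1 / k!, termwise differentiation only raises the power of A by one. *)
Lemma pseries_diffs_expmx_coef (R : realType) (M : nat) (p : R[i] -> R)
    (A : 'M[R[i]]_M) i j m :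
  pseries_diffs (expmx_coef p A i j m) = expmx_coef p A i j m.+1.
Proof.
apply/funext => k; rewrite /pseries_diffs /expmx_coef factS natrM invfM.
by rewrite addnS mulrCA mulVKf// pnatr_eq0.
Qed.

Lemma is_derive_expmx_coef (R : realType) (M : nat) (p : R[i] -> R)
    (A : 'M[R[i]]_M) i j m (t : R) :
  (forall z, `|p z| <= Normc.normc z) ->
  is_derive t (1 : R) (fun s => limn (pseries (expmx_coef p A i j m) s))
    (limn (pseries (expmx_coef p A i j m.+1) t)).
Proof.
move=> pn; rewrite -pseries_diffs_expmx_coef.
(* Termwise differentiation asks for convergence at a point of modulus greater than |t|; these
   series converge everywhere. *)
apply: (@pseries_snd_diffs _ _ (`|t| + 1));
  rewrite ?pseries_diffs_expmx_coef; try exact: is_cvg_expmx_coef.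
by rewrite [ltRHS]ger0_norm ?addr_ge0// ltrDl.
Qed.

Lemma exprmxZ (R : realType) (M : nat) (c : R[i]) (A : 'M[R[i]]_M) k :
  (c *: A) ^+ k = c ^+ k *: A ^+ k.
Proof.
elim: k => [|k ih]; first by rewrite !expr0 scale1r.
by rewrite !exprS ih -!mulmxE -scalemxAl -scalemxAr scalerA.
Qed.

(** The series is that of an entry of A^m e^{tA}. As t^k / k! is real, it splits into the two real
    power series. *)
Lemma ccvg_series_expmx (R : realType) (M : nat) (A : 'M[R[i]]_M) m t i j :
  ccvg (fun n => \sum_(k < n) (k`!%:R^-1 * (t ^+ k)%:C) * (A ^+ (m + k)) i j)
    (limn (pseries (expmx_coef Re A i j m) t) +i*
     limn (pseries (expmx_coef Im A i j m) t)).
Proof.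
have E (n k : nat) : (k`!%:R^-1 * (t ^+ k)%:C)%R = (k`!%:R^-1 * t ^+ k)%:C :> R[i].
  by rewrite rmorphM/= fmorphV/= rmorph_nat.
split=> /=.
  rewrite [X in X n @[n --> _] --> _](_ : _ = pseries (expmx_coef Re A i j m) t).
    by apply: is_cvg_expmx_coef => z; exact: ler_Re_normc.
  apply/funext => n; rewrite /pseries/= /series/= big_mkord.
  elim/big_rec2 : _ => //= k x y _ <-.
  by rewrite ReD E // ReM /= mul0r subr0 /expmx_coef; congr (_ + _); ring.
rewrite [X in X n @[n --> _] --> _](_ : _ = pseries (expmx_coef Im A i j m) t).
  by apply: is_cvg_expmx_coef => z; exact: ler_Im_normc.
apply/funext => n; rewrite /pseries/= /series/= big_mkord.
elim/big_rec2 : _ => //= k x y _ <-.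
by rewrite ImD E // ImM /= mul0r addr0 /expmx_coef; congr (_ + _); ring.
Qed.

Lemma H_mxE (R : realType) (M : nat) (A : 'M[R[i]]_M) t i j :
  H_mx A t i j = limn (pseries (expmx_coef Re A i j 0) t) +i*
                 limn (pseries (expmx_coef Im A i j 0) t).
Proof.
rewrite /H_mx /mexp (@limn_ccvg_mx _ _ _ _ (\matrix_(i, j)
   (limn (pseries (expmx_coef Re A i j 0) t) +i*
    limn (pseries (expmx_coef Im A i j 0) t)))) ?mxE// => a b; rewrite mxE.
have := ccvg_series_expmx A 0 t a b.
congr ccvg; apply/funext => n; rewrite /series/= big_mkord summxE.
by apply: eq_bigr => k _; rewrite exprmxZ !mxE add0n mulrA rmorphXn.
Qed.

(** Multiplying the partial sums for [m = 0] by A on the right gives those for [m = 1], and limits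
    are unique. This identifies the derivative of e^{At}. *)
Lemma H_mx_mulE (R : realType) (M : nat) (A : 'M[R[i]]_M) t i j :
  (H_mx A t *m A) i j = limn (pseries (expmx_coef Re A i j 1) t) +i*
                        limn (pseries (expmx_coef Im A i j 1) t).
Proof.
apply: ccvg_unique (ccvg_series_expmx A 1 t i j).
rewrite mxE.
have := ccvg_sum (index_enum 'I_M)
  (fun l => ccvgMr (A l j) (ccvg_series_expmx A 0 t i l)).
under eq_bigr do rewrite -H_mxE; congr ccvg; apply/funext => n.
under eq_bigr do rewrite mulr_suml.
rewrite exchange_big/=; apply: eq_bigr => k _.
rewrite add1n exprSr -mulmxE mxE mulr_sumr; apply: eq_bigr => l _.
by rewrite add0n mulrA.
Qed.

Lemma cderiv_H_mx (R : realType) (M : nat) (A : 'M[R[i]]_M) i j :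
  cderiv (fun t => H_mx A t i j) (fun t => (H_mx A t *m A) i j).
Proof.
move=> t; rewrite H_mx_mulE/=; split.
  have -> : Re \o (fun s => H_mx A s i j) =
      fun s => limn (pseries (expmx_coef Re A i j 0) s).
    by apply/funext => s /=; rewrite H_mxE.
  by apply: is_derive_expmx_coef => z; exact: ler_Re_normc.
have -> : Im \o (fun s => H_mx A s i j) =
    fun s => limn (pseries (expmx_coef Im A i j 0) s).
  by apply/funext => s /=; rewrite H_mxE.
by apply: is_derive_expmx_coef => z; exact: ler_Im_normc.
Qed.

(** The new factor A lands next to B, where it can later be combined into (A - z) B or, for an
    eigenvector, into z B. *)
Lemma cderiv_H_mx_mul (R : realType) (M p : nat) (A : 'M[R[i]]_M)
    (B : 'M[R[i]]_(M, p)) i j :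
  cderiv (fun t => (H_mx A t *m B) i j) (fun t => (H_mx A t *m (A *m B)) i j).
Proof.
apply: cderiv_ext (cderiv_sum (index_enum 'I_M) (fun l =>
  cderivM (cderiv_H_mx A i l) (@cderiv_cst _ (B l j)))).
  by move=> t; rewrite mxE.
move=> t; rewrite mulmxA [RHS]mxE; apply: eq_bigr => l _.
by rewrite mulr0 addr0.
Qed.

Lemma H_mx0 (R : realType) (M : nat) (A : 'M[R[i]]_M) : H_mx A 0 = 1%:M.
Proof.
apply: limn_ccvg_mx => i j.
(* Only the term k = 0 survives. The empty partial sum is 0 rather than the identity, hence the
   shift to [n.+1]. *)
have E n : (series (fun k => k`!%:R^-1 *: ((0 : R)%:C *: A) ^+ k) n.+1) i j
     = (1%:M : 'M[R[i]]_M) i j.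
  rewrite /series/= big_mkord big_ord_recl/= big1 ?addr0.
    by rewrite fact0 invr1 scale1r expr0.
  by move=> k _; rewrite scale0r expr0n scaler0.
by split; rewrite -cvg_shiftS/=; under eq_fun do rewrite E; exact: cvg_cst.
Qed.

(** * Boundedness of the exponential of a stable matrix *)

Definition cbounded (R : realType) (f : R -> R[i]) :=
  exists C : R, forall t : R, 0 <= t -> Normc.normc (f t) <= C.

Lemma normc_cexp (R : realType) (z : R[i]) : Normc.normc (cexp z) = expR (Re z).
Proof.
by rewrite /cexp /= !exprMn -mulrDr cos2Dsin2 mulr1 sqrtr_sqr ger0_norm ?expR_ge0.
Qed.

Lemma cexpN_mul (R : realType) (z : R[i]) : cexp (- z) * cexp z = 1.
Proof.
case: z => a b; rewrite /cexp /= expRN cosN sinN.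
have e0 : expR a != 0 by rewrite gt_eqF// expR_gt0.
apply: complex_eqP; rewrite ?ReM ?ImM/=.
  by rewrite -(cos2Dsin2 b); field.
by field.
Qed.

(* [f s - C / mu * expR (mu * s)] is nonincreasing on [0, +oo[. *)
Lemma derive_le_expR_bound (R : realType) (f f' : R -> R) (C mu : R) :
  0 < mu -> (forall t : R, is_derive t (1 : R) f (f' t)) ->
  (forall t : R, 0 <= t -> `|f' t| <= C * expR (mu * t)) ->
  forall t : R, 0 <= t -> `|f t| <= `|f 0| + C / mu * expR (mu * t).
Proof.
move=> mu0 df f'C.
(* The one-sided bound, applied to f and to -f, controls |f|. *)
have half (g g' : R -> R) : (forall t : R, is_derive t (1 : R) g (g' t)) ->
    (forall t : R, 0 <= t -> `|g' t| <= C * expR (mu * t)) ->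
    forall t : R, 0 <= t -> g t <= `|g 0| + C / mu * expR (mu * t).
  move=> dg g'C t t0.
  pose h := fun s : R => g s - C / mu * expR (mu * s).
  have dh (s : R) : is_derive s (1 : R) h (g' s - C * expR (mu * s)).
    have dgs := dg s.
    have dmu : is_derive s (1 : R) (fun x => mu * x) mu.
      rewrite -[X in is_derive _ _ _ X]mulr1.
      exact: (@is_deriveZ _ _ _ id mu s 1 1).
    have de := is_derive1_comp (is_derive_expR (mu * s)) dmu.
    have dz := is_deriveZ (C / mu) de.
    apply: (@is_derive_eq _ _ _ _ _ _ _ _ (is_deriveB dgs dz)).
    rewrite /GRing.scale/=; congr (_ - _); field.
    by rewrite gt_eqF.
  have dhs (s : R) : derivable h s 1 by case: (dh s).
  have C0 : 0 <= C.
    by have := g'C 0 (lexx _); rewrite mulr0 expR0 mulr1; exact: le_trans.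
  have : h t <= h 0.
    apply: (@ler0_derive1_nincry _ h 0) => //.
    - move=> s; rewrite in_itv/= andbT => /ltW s0.
      rewrite derive1E; case: (dh s) => _ ->.
      by rewrite subr_le0 (le_trans (ler_norm _))// g'C.
    - apply: continuous_subspaceT => s.
      by apply: differentiable_continuous; apply/derivable1_diffP.
  rewrite /h mulr0 expR0 mulr1.
  have : 0 <= C / mu by rewrite divr_ge0// ltW.
  by have := ler_norm (g 0); lra.
move=> t t0; rewrite ler_norml (half f f')// andbT lerNl.
rewrite -normrN; apply: (half (- f) (- f')) => // s.
by rewrite normrN; exact: f'C.
Qed.

(* [cexp (- z * t) * f t] has derivative [cexp (- z * t) * g t], which is at most
   [C * expR (- Re z * t)] in modulus. *)
Lemma cbounded_ode (R : realType) (f g : R -> R[i]) (z : R[i]) :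
  Re z < 0 -> cderiv f (fun t => z * f t + g t) -> cbounded g -> cbounded f.
Proof.
move=> z0 df [C gC]; set mu := - Re z.
have mu0 : 0 < mu by rewrite oppr_gt0.
pose h := fun t : R => cexp (- z * t%:C) * f t.
have dh : cderiv h (fun t => cexp (- z * t%:C) * g t).
  apply: cderiv_ext (cderivM (cderiv_cexp (- z)) df) => // t.
  by ring.
have hC t : 0 <= t -> Normc.normc (cexp (- z * t%:C) * g t) <= C * expR (mu * t).
  move=> t0; rewrite Normc.normcM normc_cexp mulrC ReM/= mulr0 subr0.
  have -> : Re (- z) = mu by rewrite /mu; case: (z).
  by rewrite ler_wpM2r ?gC// expR_ge0.
have hr := derive_le_expR_bound mu0 (fun t => (dh t).1)
  (fun t t0 => le_trans (ler_Re_normc _) (hC t t0)).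
have hi := derive_le_expR_bound mu0 (fun t => (dh t).2)
  (fun t t0 => le_trans (ler_Im_normc _) (hC t t0)).
have C0 : 0 <= C by exact: le_trans (normc_ge0 _) (gC 0 (lexx _)).
(* Going back from h to f multiplies by e^{Re z t}, which is at most 1 on the constant terms and
   cancels the growth e^{mu t}; the 2 counts the real and imaginary parts. *)
exists (`|Re (h 0)| + `|Im (h 0)| + 2 * (C / mu)) => t t0.
have -> : f t = cexp (z * t%:C) * h t.
  by rewrite /h mulrA [X in X * _]mulrC mulNr cexpN_mul mul1r.
rewrite Normc.normcM normc_cexp ReM/= mulr0 subr0.
have e1 : expR (Re z * t) * expR (mu * t) = 1.
  by rewrite -expRD -mulrDl addrN mul0r expR0.
have e2 : expR (Re z * t) <= 1.
  by rewrite -expR0 ler_expR nmulr_rle0.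
have e3 := expR_ge0 (Re z * t).
apply: (@le_trans _ _ (expR (Re z * t) * (`|Re (h 0)| + `|Im (h 0)|
    + 2 * (C / mu) * expR (mu * t)))).
  rewrite ler_wpM2l// (le_trans (ler_normc_ReIm _))//.
  have hr1 := hr t t0; have hi1 := hi t t0; rewrite /= in hr1 hi1; lra.
rewrite mulrDr mulrCA e1 mulr1 lerD2r.
by rewrite ler_piMl// addr_ge0.
Qed.

(** Induction on s with B arbitrary: the assumption for [z :: s] and B is the assumption for s and
    (A - z) B. The induction hypothesis thus bounds the forcing term of the equation for e^{At}
    B. *)
Lemma cbounded_H_mx_mul_prod (R : realType) (n : nat) (A : 'M[R[i]]_n.+1)
    (s : seq R[i]) (B : 'M[R[i]]_n.+1) :
  (forall z, z \in s -> Re z < 0) ->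
  (forall i j, cbounded (fun t =>
     (H_mx A t *m (horner_mx A (\prod_(z <- s) ('X - z%:P)) *m B)) i j)) ->
  forall i j, cbounded (fun t => (H_mx A t *m B) i j).
Proof.
elim: s B => [|z s ih] B s0.
  by rewrite big_nil rmorph1 mul1mx.
(* The factor X - z is moved to the right so that it acts on B first. *)
rewrite big_cons mulrC rmorphM/= rmorphB/= horner_mx_X horner_mx_C => AB i j.
apply: (@cbounded_ode _ _ (fun t => (H_mx A t *m ((A - z%:M) *m B)) i j) z).
- by apply: s0; rewrite mem_head.
- apply: cderiv_ext (cderiv_H_mx_mul A B i j) => // t.
  rewrite mulmxBl mul_scalar_mx mulmxBr -scalemxAr !mxE.
  by rewrite addrA addrAC addrN add0r.
- apply: ih => [w ws|a b]; first by apply: s0; rewrite in_cons ws orbT.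
  have := AB a b; by under eq_fun do rewrite -mulmxE -mulmxA.
Qed.

Lemma cbounded_H_mx (R : realType) (M : nat) (A : 'M[R[i]]_M)
    (lambda : 'I_M -> R[i]) :
  char_poly A = \prod_(k < M) ('X - (lambda k)%:P) ->
  (forall k, Re (lambda k) < 0) ->
  forall i j, cbounded (fun t => H_mx A t i j).
Proof.
case: M A lambda => [|n] A lambda; first by move=> _ _ [].
move=> AE l0 i j; have := @cbounded_H_mx_mul_prod _ _ A (codom lambda) 1%:M.
have -> : \prod_(z <- codom lambda) ('X - z%:P) = char_poly A.
  by rewrite AE big_image.
(* The full product annihilates A, so the function from which the factors are stripped is 0, bounded
   by 0. *)
rewrite Cayley_Hamilton => H.
under eq_fun do rewrite -[H_mx _ _]mulmx1.
apply: H => [z /codomP[k ->]//|a b].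
exists 0 => t _; rewrite mul0mx mulmx0 mxE.
by rewrite [leLHS](Normc.normc0 R).
Qed.

(** * Integrability of the Laguerre functions *)

(** x^n / n! is one term of an exponential series with nonnegative terms. *)
Lemma exprn_le_expR (R : realType) (x : R) n : 0 <= x -> x ^+ n <= n`!%:R * expR x.
Proof.
move=> x0; have n0 : (0 : R) < n`!%:R by rewrite ltr0n fact_gt0.
rewrite mulrC -ler_pdivrMr//; case: n n0 => [|n] n0.
  by rewrite expr0 divr1 -expR0 ler_expR.
by apply: le_trans (expR_ge1Dxn n x0); rewrite lerDr.
Qed.

(** The primitive is t^(b+1) / (b+1). Starting at a > 0 avoids the possible singularity at 0, and
    the bound is uniform in a. *)
Lemma integral_powR_itv1_le (R : realType) (b a : R) : -1 < b -> 0 < a < 1 ->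
  (\int[lebesgue_measure]_(t in `[a, 1%R]) (t `^ b)%:E <= ((b + 1)^-1)%:E)%E.
Proof.
move=> b1 /andP[a0 a1]; have bp : 0 < b + 1 by rewrite -ltrBlDr sub0r.
pose F (t : R) := (b + 1)^-1 *: (t `^ (b + 1)).
have dF (t : R) : 0 < t -> is_derive t (1 : R) F (t `^ b).
  move=> t0; have dp := is_derive1_powR (b + 1) t0.
  apply: (@is_derive_eq _ _ _ _ _ _ _ _ (is_deriveZ (b + 1)^-1 dp)).
  by rewrite /GRing.scale/= mulrA mulVf ?gt_eqF// mul1r addrK.
have cont (f : R -> R) (t : R) : derivable f t 1 -> {for t, continuous f}.
  by move=> ft; apply: differentiable_continuous; apply/derivable1_diffP.
have cF (t : R) : 0 < t -> {for t, continuous F}.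
  by move=> t0; apply: cont; case: (dF t t0).
rewrite (@continuous_FTC2 _ _ F)//.
- rewrite -EFinB lee_fin /F powR1 /GRing.scale/= mulr1 lerBlDr lerDl.
  by rewrite mulr_ge0 ?powR_ge0// invr_ge0 ltW.
- apply: continuous_in_subspaceT => t; rewrite inE/= in_itv/= => /andP[ta _].
  by apply: cont; apply: derivable_powR; rewrite ?in_itv/= (lt_le_trans a0).
- split.
  + move=> t; rewrite ?in_itv/= => /andP[ta _].
    by case: (dF t (lt_trans a0 ta)).
  + by apply: cvg_at_right_filter; exact: cF.
  + by apply: cvg_at_left_filter; exact: cF.
- move=> t; rewrite ?in_itv/= => /andP[ta _]; rewrite derive1E.
  by case: (dF t (lt_trans a0 ta)).
Qed.

Lemma measurable_powR_EFin (R : realType) (b : R) (D : set R) :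
  measurable_fun D (EFin \o (fun t : R => t `^ b)).
Proof. by apply/measurable_EFinP; apply: measurable_funTS. Qed.

Lemma integrable_powR_itv01 (R : realType) (b : R) : -1 < b ->
  lebesgue_measure.-integrable `]0, 1%R] (EFin \o (fun t : R => t `^ b)).
Proof.
move=> b1; apply/integrableP; split; first exact: measurable_powR_EFin.
(* These intervals exhaust ]0, 1], and monotone convergence carries the uniform bound over. The
   [n.+2] keeps the left endpoint strictly below 1. *)
pose F n : set R := `[n.+2%:R^-1, 1%R]%classic.
have FE : `]0%R, 1%R]%classic = \bigcup_n F n.
  rewrite eqEsubset; split => [x /=|x [n _]].
    rewrite ?in_itv/= => /andP[x0 x1].
    have [k] := ltr_add_invr x0; rewrite add0r => kx.
    exists k => //=; rewrite /F/= ?in_itv/= x1 andbT (le_trans _ (ltW kx))//.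
    by rewrite lef_pV2 ?posrE// ler_nat.
  rewrite /F/= ?in_itv/= => /andP[nx ->]; rewrite andbT.
  by rewrite (lt_le_trans _ nx).
under eq_integral do rewrite gee0_abs ?lee_fin ?powR_ge0//.
rewrite FE (@le_lt_trans _ _ ((b + 1)^-1)%:E) ?ltry//.
have H : (\int[lebesgue_measure]_(t in F n) (t `^ b)%:E)%E @[n --> \oo] -->
    (\int[lebesgue_measure]_(t in \bigcup_n F n) (t `^ b)%:E)%E.
  apply: ge0_nondecreasing_set_cvg_integral.
  - apply/nondecreasing_seqP => n; rewrite subsetEset => x; rewrite /F /= ?in_itv/=.
    move=> /andP[nx ->]; rewrite andbT (le_trans _ nx)//.
    by rewrite lef_pV2 ?posrE// ler_nat.
  - by move=> n; exact: measurable_itv.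
  - by move=> n; exact: measurable_powR_EFin.
  - by move=> n x _; rewrite lee_fin powR_ge0.
have <- := cvg_lim (@ereal_hausdorff R) H; apply: lime_le.
  by apply/cvg_ex; eexists; exact: H.
apply: nearW => n; apply: integral_powR_itv1_le => //.
by rewrite invr_gt0// ltr0n/= invf_lt1// ltr1n.
Qed.

(** The dominating function is t^b on ]0, 1] plus a multiple of the exponential density of rate c /
    2: half of the decay absorbs the power of t. *)
Lemma integrable_powR_expR (R : realType) (b c : R) : -1 < b -> 0 < c ->
  lebesgue_measure.-integrable `]0, +oo[
    (EFin \o (fun t : R => t `^ b * expR (- (c * t)))).
Proof.
move=> b1 c0; pose r := c / 2; have r0 : 0 < r by rewrite divr_gt0.
have [m bm] : exists m : nat, b <= m%:R.
  by exists (Num.truncn `|b|).+1; rewrite (le_trans (ler_norm _))// ltW// truncnS_gt.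
(* For t > 1, t^b <= t^m <= K e^{rt}, from (rt)^m <= m! e^{rt}. Dividing by r in g offsets the
   factor r of the density. *)
pose K := m`!%:R / r ^+ m.
pose g : measurableTypeR R -> \bar R := ((fun t : R => (t `^ b)%:E) \_ `]0%R, 1%R] \+
   (fun t : R => (K / r)%:E * (exponential_pdf r t)%:E))%E.
have K0 : 0 <= K by rewrite divr_ge0// exprn_ge0// ltW.
have gi : lebesgue_measure.-integrable setT g.
  apply: integrableD => //.
    have mI : measurable (`]0, 1%R]%classic : set (measurableTypeR R)).
      exact: measurable_itv.
    exact: ((integrable_mkcond _ mI).1 (integrable_powR_itv01 b1)).
  by apply: integrableZl => //; exact: integrable_exponential_pdf.
apply: (@le_integrable _ _ _ _ _ _ _ g) => //; last exact: (@integrableS _ _ _ _ setT).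
  apply/measurable_EFinP; apply: measurable_funM; first exact: measurable_funTS.
  apply: measurable_funTS; apply: continuous_measurable_fun => x.
  apply: continuous_comp; last exact: continuous_expR.
  by apply: continuousN; apply: mulrl_continuous.
move=> t /=; rewrite ?in_itv/= andbT => t0.
have et0 := expR_ge0 (- (c * t)); have tb0 := powR_ge0 t b.
have p0 : 0 <= K / r * exponential_pdf r t.
  by apply: mulr_ge0; [rewrite divr_ge0// ltW|exact: exponential_pdf_ge0 (ltW r0) _].
rewrite /g/= patchE; case: ifPn => t1.
  rewrite -EFinM -EFinD /= lee_fin [leLHS]ger0_norm ?mulr_ge0//.
  rewrite [leRHS]ger0_norm; last exact: addr_ge0.
  rewrite (@le_trans _ _ (t `^ b))//; last by rewrite lerDl.
  by rewrite ler_piMr// expR_le1 oppr_le0 mulr_ge0// ltW.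
have {}t1 : 1 < t.
  by rewrite ltNge; apply: contraNN t1 => t1; rewrite inE/= in_itv/= t0 t1.
rewrite -EFinM add0e /= lee_fin [leLHS]ger0_norm ?mulr_ge0// [leRHS]ger0_norm//.
rewrite exponential_pdfE ?(ltW t0)//.
have -> : K / r * (r * expR (- r * t)) = K * expR (- r * t).
  by rewrite mulrA divfK// gt_eqF.
have -> : - (c * t) = - r * t + - (r * t) by rewrite /r; field.
rewrite expRD mulrCA [leRHS]mulrC ler_wpM2l ?expR_ge0//.
rewrite expRN ler_pdivrMr ?expR_gt0//.
rewrite (le_trans (ler_powR (ltW t1) bm))// powR_mulrn ?(ltW t0)//.
rewrite /K mulrAC ler_pdivlMr ?exprn_gt0// mulrC -exprMn.
by apply: exprn_le_expR; rewrite mulr_ge0 ?ltW.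
Qed.

Lemma measurable_laguerre_fun (R : realType) (tau alpha : R) n :
  measurable_fun setT (laguerre_fun tau alpha n).
Proof.
have cM (c : R) : continuous (fun t : R => c * t) by exact: mulrl_continuous.
apply: measurable_funM.
  apply: measurable_funM; first exact: measurable_funM.
  apply: continuous_measurable_fun => x.
  apply: continuous_comp; last exact: continuous_expR.
  by apply: continuousN; apply: continuousM; [exact: cM|exact: cst_continuous].
rewrite /laguerre_poly; apply: measurable_sum => k.
apply: measurable_funM => //; apply: measurable_funM => //.
apply: (measurableT_comp (@exprn_measurable R setT k)).
by apply: continuous_measurable_fun; exact: cM.
Qed.

(** Each monomial satisfies t^k / k! <= c^{-k} e^{ct}, so the growth rate c can be as small as
    desired. *)
Lemma laguerre_poly_bound (R : realType) (alpha c : R) n : 0 < c ->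
  exists2 K : R, 0 <= K &
    forall t, 0 <= t -> `|laguerre_poly alpha n t| <= K * expR (c * t).
Proof.
move=> c0.
exists (\sum_(k < n.+1) `|gbinom (n%:R + alpha) (n - k)| * c ^- k).
  by apply: sumr_ge0 => k _; rewrite mulr_ge0// invr_ge0 exprn_ge0// ltW.
move=> t t0; rewrite (le_trans (ler_norm_sum _ _ _))// mulr_suml.
apply: ler_sum => k _; rewrite normrM normrM normrX normrN1 expr1n mul1r.
rewrite [X in _ * X]normrM -[leRHS]mulrA ler_wpM2l// normrX normfV !ger0_norm//.
rewrite ler_pdivrMr ?ltr0n ?fact_gt0// -mulrA mulrC ler_pdivlMr ?exprn_gt0//.
rewrite -exprMn [t * c]mulrC [leRHS]mulrC.
by rewrite exprn_le_expR// mulr_ge0// ltW.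
Qed.

Lemma integrable_laguerre_fun (R : realType) (tau alpha : R) n :
  0 < tau -> -1 < alpha ->
  lebesgue_measure.-integrable `[0, +oo[ (EFin \o laguerre_fun tau alpha n).
Proof.
move=> tau0 alpha1.
have mf D : measurable_fun D (EFin \o laguerre_fun tau alpha n).
  by apply/measurable_EFinP; apply: measurable_funTS; exact: measurable_laguerre_fun.
(* The point 0 is negligible and is removed. *)
suff /integrableP[_ H] : lebesgue_measure.-integrable `]0, +oo[
    (EFin \o laguerre_fun tau alpha n).
  apply/integrableP; split; first exact: mf.
  by move: H; rewrite integral_itv_obnd_cbnd//; apply: measurableT_comp => //;
    exact: mf.
(* With rate 1/4 the polynomial at tau t costs e^{tau t/4}, half of the available decay e^{-tau
   t/2}. *)
have [K K0 LK] := @laguerre_poly_bound _ alpha (1 / 4) n ltac:(by []).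
set C := Num.sqrt (n`!%:R / Gamma (n%:R + alpha + 1)) * tau `^ ((alpha + 1) / 2).
have t40 : 0 < tau / 4 by rewrite divr_gt0.
have a2 : -1 < alpha / 2 by lra.
have := integrable_powR_expR a2 t40.
have mI : measurable (`]0, +oo[%classic : set (measurableTypeR R)).
  exact: measurable_itv.
move=> /(integrableZl mI (C * K)).
apply: le_integrable => //; first exact: mf.
move=> t; rewrite /= ?in_itv/= andbT => t0.
rewrite lee_fin /laguerre_fun -/C.
have C0 : 0 <= C by rewrite mulr_ge0 ?sqrtr_ge0 ?powR_ge0.
clearbody C; have e0 := expR_ge0 (- (tau * t / 2)); have p0 := powR_ge0 t (alpha / 2).
rewrite [leRHS]ger0_norm; last by rewrite !mulr_ge0 ?expR_ge0.
rewrite normrM ger0_norm; last by rewrite !mulr_ge0.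
have /LK : 0 <= tau * t by rewrite mulr_ge0// ltW.
have -> : - (tau / 4 * t) = - (tau * t / 2) + 1 / 4 * (tau * t) by field.
rewrite expRD => H.
have -> : C * K * (t `^ (alpha / 2) * (expR (- (tau * t / 2)) *
    expR (1 / 4 * (tau * t)))) =
  C * t `^ (alpha / 2) * expR (- (tau * t / 2)) * (K * expR (1 / 4 * (tau * t))).
  by ring.
by rewrite ler_wpM2l// mulr_ge0 ?expR_ge0// mulr_ge0 ?powR_ge0.
Qed.

(** * Complex integrals and eigenvectors *)

Definition cintegrable (R : realType) (f : R -> R[i]) :=
  lebesgue_measure.-integrable `[0, +oo[ (EFin \o (fun t => Re (f t))) /\
  lebesgue_measure.-integrable `[0, +oo[ (EFin \o (fun t => Im (f t))).

Lemma measurable_itv0y (R : realType) :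
  measurable (`[0, +oo[%classic : set (measurableTypeR R)).
Proof. exact: measurable_itv. Qed.

Lemma cintegralD (R : realType) (f g : R -> R[i]) :
  cintegrable f -> cintegrable g ->
  cintegrable (fun t => f t + g t) /\
  cintegral (fun t => f t + g t) = cintegral f + cintegral g.
Proof.
move=> [fr fi] [gr gi]; have mI := @measurable_itv0y R.
split; last first.
  rewrite /cintegral; under eq_Rintegral do rewrite ReD.
  under [X in _ +i* X]eq_Rintegral do rewrite ImD.
  by rewrite !RintegralD.
split.
  apply: eq_integrable (integrableD mI fr gr) => // t _.
  by rewrite /= ReD.
apply: eq_integrable (integrableD mI fi gi) => // t _.
by rewrite /= ImD.
Qed.

Lemma cintegralMr (R : realType) (f : R -> R[i]) (c : R[i]) :
  cintegrable f -> cintegrable (fun t => f t * c) /\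
  cintegral (fun t => f t * c) = cintegral f * c.
Proof.
move=> [fr fi]; have mI := @measurable_itv0y R.
have cI (r : R) g : lebesgue_measure.-integrable `[0, +oo[ (EFin \o g) ->
    lebesgue_measure.-integrable `[0, +oo[ (EFin \o (fun t : R => r * g t)).
  by move=> gI; apply: eq_integrable (integrableZl mI r gI).
have rE : (fun t : R => Re (f t * c)) = fun t => Re c * Re (f t) + - Im c * Im (f t).
  by apply/funext => t; rewrite ReM; ring.
have iE : (fun t : R => Im (f t * c)) = fun t => Im c * Re (f t) + Re c * Im (f t).
  by apply/funext => t; rewrite ImM; ring.
split.
  by rewrite /cintegrable rE iE; split;
    apply: eq_integrable (integrableD mI (cI _ _ _) (cI _ _ _)).
rewrite /cintegral rE iE !RintegralD ?RintegralZl//; try exact: cI.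
by apply: complex_eqP; rewrite ?ReM ?ImM /=; ring.
Qed.

Lemma cintegral_sum (R : realType) (I : Type) (s : seq I) (f : I -> R -> R[i]) :
  (forall i, cintegrable (f i)) ->
  cintegrable (fun t => \sum_(i <- s) f i t) /\
  cintegral (fun t => \sum_(i <- s) f i t) = \sum_(i <- s) cintegral (f i).
Proof.
move=> fI; elim: s => [|i s [ih1 ih2]].
  have E : (fun t : R => \sum_(i <- [::]) f i t) = fun=> 0.
    by apply/funext => t; rewrite big_nil.
  rewrite E big_nil; split; first by split; exact: integrable0.
  by rewrite /cintegral /Rintegral !integral0.
have E : (fun t : R => \sum_(j <- i :: s) f j t) =
    fun t => f i t + \sum_(j <- s) f j t.
  by apply/funext => t; rewrite big_cons.
by rewrite E big_cons -ih2; exact: cintegralD.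
Qed.

Definition cmeasurable (R : realType) (f : R -> R[i]) :=
  measurable_fun setT (fun t => Re (f t)) /\
  measurable_fun setT (fun t => Im (f t)).

Lemma cmeasurable_cderiv (R : realType) (f f' : R -> R[i]) :
  cderiv f f' -> cmeasurable f.
Proof.
move=> df; have cont (h h' : R -> R) :
    (forall t, is_derive t (1 : R) h (h' t)) -> measurable_fun setT h.
  move=> dh; apply: continuous_measurable_fun => t.
  apply: differentiable_continuous; apply/derivable1_diffP.
  by case: (dh t).
split; first exact: (cont _ _ (fun t => (df t).1)).
exact: (cont _ _ (fun t => (df t).2)).
Qed.

(** Both parts of f l are dominated by C |l|. It is applied to the entries of e^{At} and to e^{zt},
    with l a Laguerre function. *)
Lemma cintegrable_bounded_mul (R : realType) (f : R -> R[i]) (l : R -> R) :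
  cmeasurable f -> cbounded f -> measurable_fun setT l ->
  lebesgue_measure.-integrable `[0, +oo[ (EFin \o l) ->
  cintegrable (fun t => f t * (l t)%:C).
Proof.
move=> [fr fi] [C fC] ml lI; have mI := @measurable_itv0y R.
have bI (p : R -> R) : measurable_fun setT p ->
    (forall t, 0 <= t -> `|p t| <= C) ->
    lebesgue_measure.-integrable `[0, +oo[ (EFin \o (fun t => p t * l t)).
  move=> mp pC; apply: le_integrable (integrableZl mI C lI) => //.
    by apply/measurable_EFinP; apply: measurable_funTS; exact: measurable_funM.
  move=> t; rewrite /= in_itv/= andbT => t0.
  have C0 : 0 <= C := le_trans (normr_ge0 _) (pC t t0).
  by rewrite lee_fin !normrM (ger0_norm C0) ler_wpM2r// pC.
have fRC (t : R) : 0 <= t -> `|Re (f t)| <= C.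
  by move=> t0; exact: le_trans (ler_Re_normc _) (fC t t0).
have fIC (t : R) : 0 <= t -> `|Im (f t)| <= C.
  by move=> t0; exact: le_trans (ler_Im_normc _) (fC t t0).
split.
  apply: eq_integrable (bI _ fr fRC) => // t _.
  by rewrite /= ReM/= mulr0 subr0.
apply: eq_integrable (bI _ fi fIC) => // t _.
by rewrite /= ImM/= mulr0 add0r.
Qed.

(** * Action of the exponential and of its Laguerre expansion on eigenvectors *)

Lemma cexp0 (R : realType) : cexp (0 : R[i]) = 1.
Proof. by rewrite /cexp/= expR0 cos0 sin0 mulr0 mulr1. Qed.

(** Each entry of e^{-zs} e^{As} v has derivative 0 because A v = z v, hence keeps its value at s =
    0, an entry of v. *)
Lemma H_mx_eigenvector (R : realType) (M : nat) (A : 'M[R[i]]_M) (z : R[i])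
    (v : 'cV[R[i]]_M) (t : R) :
  A *m v = z *: v -> H_mx A t *m v = cexp (z * t%:C) *: v.
Proof.
move=> Av; apply/colP => i.
pose q := fun s : R => cexp (- z * s%:C) * (H_mx A s *m v) i 0.
have dq : cderiv q (fun=> 0).
  apply: cderiv_ext (cderivM (cderiv_cexp (- z)) (cderiv_H_mx_mul A v i 0)) => // s.
  by rewrite Av -scalemxAr [X in _ + _ * X]mxE; ring.
have q0 : q t = q 0.
  have dr s : is_derive s (1 : R) (Re \o q) 0 by have [] := dq s.
  have di s : is_derive s (1 : R) (Im \o q) 0 by have [] := dq s.
  apply: complex_eqP.
    exact: (@is_derive_0_is_cst R (Re \o q)).
  exact: (@is_derive_0_is_cst R (Im \o q)).
have {q0} : q t = v i 0.
  by rewrite q0 /q H_mx0 mul1mx (_ : (0 : R)%:C = 0)// mulr0 cexp0 mul1r.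
rewrite /q => E; rewrite [RHS]mxE -E mulrA [X in X * _]mulrC mulNr.
by rewrite cexpN_mul mul1r.
Qed.

Lemma cintegrable_H_mx (R : realType) (M : nat) (A : 'M[R[i]]_M)
    (tau alpha : R) n i j :
  (forall i j, cbounded (fun t => H_mx A t i j)) -> 0 < tau -> -1 < alpha ->
  cintegrable (fun t => H_mx A t i j * (laguerre_fun tau alpha n t)%:C).
Proof.
move=> HA tau0 alpha1; apply: cintegrable_bounded_mul => //.
- exact: cmeasurable_cderiv (cderiv_H_mx A i j).
- exact: measurable_laguerre_fun.
- exact: integrable_laguerre_fun.
Qed.

Lemma cintegrable_cexp (R : realType) (z : R[i]) (tau alpha : R) n :
  Re z < 0 -> 0 < tau -> -1 < alpha ->
  cintegrable (fun t => cexp (z * t%:C) * (laguerre_fun tau alpha n t)%:C).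
Proof.
move=> z0 tau0 alpha1; apply: cintegrable_bounded_mul.
- exact: cmeasurable_cderiv (cderiv_cexp z).
- exists 1 => t t0; rewrite normc_cexp ReM/= mulr0 subr0.
  by rewrite -expR0 ler_expR nmulr_rle0.
- exact: measurable_laguerre_fun.
- exact: integrable_laguerre_fun.
Qed.

(** Integrability of the entries lets the finite sum defining the product with v pass under the
    integral, where e^{At} v becomes e^{zt} v. *)
Lemma S_mx_eigenvector (R : realType) (M : nat) (A : 'M[R[i]]_M) (z : R[i])
    (v : 'cV[R[i]]_M) n (tau alpha : R) :
  (forall i j, cbounded (fun t => H_mx A t i j)) -> Re z < 0 ->
  0 < tau -> -1 < alpha ->
  A *m v = z *: v -> S_mx n tau alpha A *m v = s_coef n tau alpha z *: v.
Proof.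
move=> HA z0 tau0 alpha1 Av; apply/colP => i; rewrite !mxE.
pose l t := (laguerre_fun tau alpha n t)%:C.
have Hl j := @cintegralMr _ _ (v j 0) (cintegrable_H_mx n i j HA tau0 alpha1).
rewrite /s_coef.
rewrite -(cintegralMr (v i 0) (cintegrable_cexp n z0 tau0 alpha1)).2.
rewrite -/l; under eq_bigr do rewrite mxE -(Hl _).2.
rewrite -(cintegral_sum (index_enum 'I_M) (fun j => (Hl j).1)).2.
congr cintegral; apply/funext => t.
have := congr1 (fun u : 'cV_M => u i 0 * l t) (H_mx_eigenvector t Av).
rewrite /= !mxE mulr_suml mulrAC => <-.
by apply: eq_bigr => j _; rewrite mulrAC.
Qed.

Lemma error_eigenvector (R : realType) (M : nat) (A : 'M[R[i]]_M) (z : R[i])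
    (v : 'cV[R[i]]_M) N (tau alpha t : R) :
  (forall i j, cbounded (fun t => H_mx A t i j)) -> Re z < 0 ->
  0 < tau -> -1 < alpha -> A *m v = z *: v ->
  (H_mx A t - HN_mx N tau alpha A t) *m v =
  (cexp (z * t%:C) - \sum_(n < N.+1)
     s_coef n tau alpha z * (laguerre_fun tau alpha n t)%:C) *: v.
Proof.
move=> HA z0 tau0 alpha1 Av; rewrite mulmxBl scalerBl (H_mx_eigenvector _ Av).
congr (_ - _); rewrite /HN_mx mulmx_suml scaler_suml.
apply: eq_bigr => n _; rewrite -scalemxAl (S_mx_eigenvector n HA z0 tau0 alpha1 Av).
by rewrite scalerA mulrC.
Qed.

(** * Euclidean, operator and Frobenius norms *)

Lemma CauchySchwarz_sum (R : realType) (I : finType) (a b : I -> R) :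
  (\sum_i a i * b i) ^+ 2 <= (\sum_i a i ^+ 2) * (\sum_i b i ^+ 2).
Proof.
(* Lagrange's identity *)
have : 0 <= \sum_i \sum_j (a i * b j - a j * b i) ^+ 2.
  by do 2!(apply: sumr_ge0 => ? _); exact: sqr_ge0.
have -> : \sum_i \sum_j (a i * b j - a j * b i) ^+ 2 =
    2 * ((\sum_i a i ^+ 2) * (\sum_i b i ^+ 2)) - 2 * (\sum_i a i * b i) ^+ 2.
  have E (u v : I -> R) : (\sum_i u i) * (\sum_i v i) = \sum_i \sum_j u i * v j.
    by rewrite mulr_suml; apply: eq_bigr => i _; rewrite mulr_sumr.
  rewrite expr2 mulr2n !mulrDl !mul1r {2}[(\sum_i a i ^+ 2) * _]mulrC !E.
  rewrite -!big_split/= -sumrB; apply: eq_bigr => i _.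
  rewrite -!big_split/= -sumrB; apply: eq_bigr => j _.
  by ring.
lra.
Qed.

Lemma euclid_norm_ge0 (R : realType) (M : nat) (x : 'cV[R[i]]_M) :
  0 <= euclid_norm x.
Proof. exact: sqrtr_ge0. Qed.

Lemma sqr_euclid_norm (R : realType) (M : nat) (x : 'cV[R[i]]_M) :
  euclid_norm x ^+ 2 = \sum_(i < M) Normc.normc (x i 0) ^+ 2.
Proof. by rewrite sqr_sqrtr// sumr_ge0// => i _; exact: sqr_ge0. Qed.

Lemma frobenius_norm_ge0 (R : realType) (M : nat) (C : 'M[R[i]]_M) :
  0 <= frobenius_norm C.
Proof. exact: sqrtr_ge0. Qed.

Lemma sqr_frobenius_norm (R : realType) (M : nat) (C : 'M[R[i]]_M) :
  frobenius_norm C ^+ 2 = \sum_(i < M) \sum_(j < M) Normc.normc (C i j) ^+ 2.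
Proof.
by rewrite sqr_sqrtr// sumr_ge0// => i _; rewrite sumr_ge0// => j _; exact: sqr_ge0.
Qed.

(** The pairing is bilinear, without conjugation, to match matrix products; the triangle inequality
    reduces it to the real Cauchy-Schwarz inequality for moduli. *)
Lemma normc_dot_le (R : realType) (M : nat) (x y : 'cV[R[i]]_M) :
  Normc.normc (\sum_i x i 0 * y i 0) <= euclid_norm x * euclid_norm y.
Proof.
rewrite -(ler_pXn2r (ltn0Sn 1)) ?nnegrE ?mulr_ge0 ?normc_ge0 ?euclid_norm_ge0//.
rewrite exprMn !sqr_euclid_norm.
apply: le_trans (CauchySchwarz_sum (fun i => Normc.normc (x i 0)) _).
rewrite ler_pXn2r ?nnegrE ?normc_ge0//.
  by apply: le_trans (normc_sum _ _) _; apply: ler_sum => i _; rewrite Normc.normcM.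
by apply: sumr_ge0 => i _; rewrite mulr_ge0 ?normc_ge0.
Qed.

(** Cauchy-Schwarz is applied to each row of C. *)
Lemma euclid_norm_mul_le (R : realType) (M : nat) (C : 'M[R[i]]_M)
    (x : 'cV[R[i]]_M) :
  euclid_norm (C *m x) <= frobenius_norm C * euclid_norm x.
Proof.
rewrite -(ler_pXn2r (ltn0Sn 1)) ?nnegrE ?mulr_ge0 ?frobenius_norm_ge0
  ?euclid_norm_ge0//.
rewrite exprMn sqr_euclid_norm sqr_frobenius_norm mulr_suml.
apply: ler_sum => i _; pose r : 'cV[R[i]]_M := \col_j C i j.
have -> : (C *m x) i 0 = \sum_j r j 0 * x j 0.
  by rewrite mxE; apply: eq_bigr => j _; rewrite mxE.
have -> : \sum_j Normc.normc (C i j) ^+ 2 = euclid_norm r ^+ 2.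
  by rewrite sqr_euclid_norm; apply: eq_bigr => j _; rewrite mxE.
rewrite -exprMn ler_pXn2r ?nnegrE ?mulr_ge0 ?normc_ge0 ?euclid_norm_ge0//.
exact: normc_dot_le.
Qed.

Lemma euclid_normZ (R : realType) (M : nat) (c : R[i]) (x : 'cV[R[i]]_M) :
  euclid_norm (c *: x) = Normc.normc c * euclid_norm x.
Proof.
apply: (@pexpIrn _ 2) => //; rewrite ?nnegrE ?mulr_ge0 ?normc_ge0 ?euclid_norm_ge0//.
rewrite exprMn !sqr_euclid_norm mulr_sumr; apply: eq_bigr => i _.
by rewrite mxE Normc.normcM exprMn.
Qed.

Lemma euclid_norm_eq0 (R : realType) (M : nat) (x : 'cV[R[i]]_M) :
  euclid_norm x = 0 -> x = 0.
Proof.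
move=> x0; have := sqr_euclid_norm x; rewrite x0 expr0n/= => /esym/eqP.
rewrite psumr_eq0 => [/allP H|i _]; last exact: sqr_ge0.
apply/colP => i; rewrite mxE; apply: Normc.eq0_normc.
by apply/eqP; rewrite -sqrf_eq0; apply: H; rewrite mem_index_enum.
Qed.

Lemma normc_real (R : realType) (r : R) : 0 <= r -> Normc.normc r%:C = r.
Proof. by move=> r0; rewrite /= expr0n/= addr0 sqrtr_sqr ger0_norm. Qed.

(** [sup] is a true least upper bound only for a nonempty bounded set; the zero vector gives a
    member and the Frobenius norm an upper bound. *)
Lemma has_sup_op_norm (R : realType) (M : nat) (T : 'M[R[i]]_M) :
  has_sup [set euclid_norm (T *m x) | x in [set x : 'cV[R[i]]_M | euclid_norm x <= 1]].
Proof.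
split.
  exists (euclid_norm (T *m 0)), 0 => //=.
  have -> : euclid_norm (0 : 'cV[R[i]]_M) = 0 by
    rewrite -(scale0r 0) euclid_normZ [X in X * _](Normc.normc0 R) mul0r.
  exact: ler01.
exists (frobenius_norm T) => _ [x /= x1 <-].
apply: le_trans (euclid_norm_mul_le _ _) _.
by rewrite ler_piMr// frobenius_norm_ge0.
Qed.

Lemma op_norm_ge0 (R : realType) (M : nat) (T : 'M[R[i]]_M) : 0 <= op_norm T.
Proof.
have [[y [x x1 _]] ub] := has_sup_op_norm T.
apply: (le_trans (euclid_norm_ge0 (T *m x))).
by apply: ub_le_sup => //; exists x.
Qed.

Lemma op_norm_bound (R : realType) (M : nat) (T : 'M[R[i]]_M) (x : 'cV[R[i]]_M) :
  euclid_norm (T *m x) <= op_norm T * euclid_norm x.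
Proof.
(* A nonzero x is scaled to length 1; the zero vector is settled first. *)
have [x0|x0] := eqVneq (euclid_norm x) 0.
  by rewrite (euclid_norm_eq0 x0) mulmx0 -(euclid_norm_eq0 x0) x0 mulr0.
have xgt0 : 0 < euclid_norm x by rewrite lt_neqAle eq_sym x0 euclid_norm_ge0.
rewrite -ler_pdivrMr// mulrC -(@normc_real _ (euclid_norm x)^-1); last first.
  by rewrite invr_ge0 ltW.
rewrite -euclid_normZ scalemxAr; apply: ub_le_sup; first exact: (has_sup_op_norm T).2.
exists ((euclid_norm x)^-1%:C *: x) => //=.
by rewrite euclid_normZ normc_real ?invr_ge0 ?euclid_norm_ge0// mulVf.
Qed.

(* Duality: with w the conjugate of T^T x, the square of |T^T x| is the product
   of x and T w, hence at most |x| ||T|| |T^T x|. *)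
Lemma op_norm_bound_tr (R : realType) (M : nat) (T : 'M[R[i]]_M)
    (x : 'cV[R[i]]_M) :
  euclid_norm (T^T *m x) <= op_norm T * euclid_norm x.
Proof.
pose w : 'cV[R[i]]_M := map_mx (@conjc _) (T^T *m x).
have nc (z : R[i]) : Normc.normc (conjc z) = Normc.normc z.
  by case: z => a b /=; rewrite sqrrN.
have ew : euclid_norm w = euclid_norm (T^T *m x).
  by congr Num.sqrt; apply: eq_bigr => i _; rewrite mxE nc.
have E : (euclid_norm (T^T *m x) ^+ 2)%:C = \sum_i x i 0 * (T *m w) i 0.
  rewrite sqr_euclid_norm rmorph_sum/=.
  transitivity (\sum_j (T^T *m x) j 0 * w j 0).
    apply: eq_bigr => j _; rewrite [w _ _]mxE normc_sqr.
    case: ((T^T *m x) j 0) => a b; apply: complex_eqP; rewrite ?ReM ?ImM/=; ring.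
  under [LHS]eq_bigr do rewrite [X in X * _]mxE mulr_suml.
  under [RHS]eq_bigr do rewrite [X in _ * X]mxE mulr_sumr.
  rewrite exchange_big; apply: eq_bigr => i _; apply: eq_bigr => j _.
  by rewrite [T^T _ _]mxE; ring.
have := normc_dot_le x (T *m w); rewrite -E normc_real ?sqr_ge0// => H.
have [->|n0] := eqVneq (euclid_norm (T^T *m x)) 0.
  by rewrite mulr_ge0 ?op_norm_ge0 ?euclid_norm_ge0.
have n1 : 0 < euclid_norm (T^T *m x) by rewrite lt_neqAle eq_sym n0 euclid_norm_ge0.
rewrite -(ler_pM2r n1) -expr2 (le_trans H)// mulrAC [leRHS]mulrC.
rewrite ler_wpM2l ?euclid_norm_ge0// -ew; exact: op_norm_bound.
Qed.

(** The squared Frobenius norm is the sum of the squared column lengths, and S acts on each column.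
    A general c serves both T and the transpose of its inverse. *)
Lemma frobenius_norm_mul_le (R : realType) (M : nat) (S B : 'M[R[i]]_M) (c : R) :
  0 <= c -> (forall x : 'cV_M, euclid_norm (S *m x) <= c * euclid_norm x) ->
  frobenius_norm (S *m B) <= c * frobenius_norm B.
Proof.
move=> c0 Sc; have E (C : 'M[R[i]]_M) :
    frobenius_norm C ^+ 2 = \sum_j euclid_norm (col j C) ^+ 2.
  rewrite sqr_frobenius_norm exchange_big; apply: eq_bigr => j _.
  by rewrite sqr_euclid_norm; apply: eq_bigr => i _; rewrite mxE.
rewrite -(ler_pXn2r (ltn0Sn 1)) ?nnegrE ?mulr_ge0 ?frobenius_norm_ge0//.
rewrite exprMn !E mulr_sumr; apply: ler_sum => j _; rewrite -exprMn.
by rewrite ler_pXn2r ?nnegrE ?mulr_ge0 ?euclid_norm_ge0// !colE -mulmxA.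
Qed.

Lemma frobenius_norm_tr (R : realType) (M : nat) (C : 'M[R[i]]_M) :
  frobenius_norm C^T = frobenius_norm C.
Proof.
rewrite /frobenius_norm exchange_big; congr Num.sqrt.
by apply: eq_bigr => i _; apply: eq_bigr => j _; rewrite mxE.
Qed.

(** Transposition preserves the Frobenius norm and turns the right factor into a left one, bounded
    by [op_norm_bound_tr]; the factor T is then bounded directly. *)
Lemma frobenius_norm_conj_le (R : realType) (M : nat) (T B : 'M[R[i]]_M) :
  frobenius_norm (T *m B *m invmx T) <= cond_num T * frobenius_norm B.
Proof.
rewrite /cond_num mulrAC mulrC -frobenius_norm_tr trmx_mul.
apply: le_trans (frobenius_norm_mul_le _ (op_norm_ge0 _) (@op_norm_bound_tr _ _ _)) _.
rewrite ler_wpM2l ?op_norm_ge0// frobenius_norm_tr.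
exact: frobenius_norm_mul_le (op_norm_ge0 _) (@op_norm_bound _ _ _).
Qed.

Lemma sqr_frobenius_norm_diag (R : realType) (M : nat) (d : 'rV[R[i]]_M) :
  frobenius_norm (diag_mx d) ^+ 2 = \sum_j Normc.normc (d 0 j) ^+ 2.
Proof.
rewrite sqr_frobenius_norm; apply: eq_bigr => i _; rewrite (bigD1 i)//= big1.
  by rewrite addr0 mxE eqxx mulr1n.
move=> j ji; rewrite mxE eq_sym (negbTE ji) mulr0n.
by rewrite [X in X ^+ 2](Normc.normc0 R) expr0n.
Qed.

(** * The two error bounds *)

Lemma cmeasurableD (R : realType) (f g : R -> R[i]) :
  cmeasurable f -> cmeasurable g -> cmeasurable (fun t => f t + g t).
Proof.
move=> [fr fi] [gr gi]; split.
  by under eq_fun do rewrite ReD; exact: measurable_funD.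
by under eq_fun do rewrite ImD; exact: measurable_funD.
Qed.

Lemma cmeasurableMl (R : realType) (c : R[i]) (f : R -> R[i]) :
  cmeasurable f -> cmeasurable (fun t => c * f t).
Proof.
move=> [fr fi]; split.
  by under eq_fun do rewrite ReM; apply: measurable_funB; exact: measurable_funM.
by under eq_fun do rewrite ImM; apply: measurable_funD; exact: measurable_funM.
Qed.

Lemma cmeasurable_real (R : realType) (f : R -> R) :
  measurable_fun setT f -> cmeasurable (fun t => (f t)%:C).
Proof. by []. Qed.

Lemma cmeasurable_sum (R : realType) (I : Type) (s : seq I) (f : I -> R -> R[i]) :
  (forall i, cmeasurable (f i)) -> cmeasurable (fun t => \sum_(i <- s) f i t).
Proof.
move=> fm; elim: s => [|i s ih].
  by under eq_fun do rewrite big_nil; exact: (@cmeasurable_real _ (fun=> 0)).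
by under eq_fun do rewrite big_cons; exact: cmeasurableD.
Qed.

Lemma cmeasurableB (R : realType) (f g : R -> R[i]) :
  cmeasurable f -> cmeasurable g -> cmeasurable (fun t => f t - g t).
Proof.
move=> fm gm; under eq_fun do rewrite -mulN1r.
by apply: cmeasurableD => //; exact: cmeasurableMl.
Qed.

Lemma measurable_normc_sqr (R : realType) (f : R -> R[i]) :
  cmeasurable f -> measurable_fun setT (fun t => Normc.normc (f t) ^+ 2).
Proof.
move=> [fr fi]; under eq_fun do rewrite normc_sqr.
by apply: measurable_funD; apply: (measurableT_comp (@exprn_measurable R setT 2)).
Qed.

(** * Characteristic polynomials and column eigenvectors *)

Lemma char_poly_tr (F : comNzRingType) (n : nat) (A : 'M[F]_n) :
  char_poly A^T = char_poly A.
Proof.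
rewrite /char_poly -[RHS]det_tr; congr (\det _).
by apply/matrixP => i j; rewrite !mxE eq_sym.
Qed.

(** X - T D T^{-1} = T (X - D) T^{-1} over the polynomials, and the outer determinants cancel. *)
Lemma char_poly_conj (F : comUnitRingType) (n : nat) (T D : 'M[F]_n) :
  T \in unitmx -> char_poly (T *m D *m invmx T) = char_poly D.
Proof.
move=> Tu; rewrite /char_poly.
have TV : map_mx polyC T *m map_mx polyC (invmx T) = 1%:M.
  by rewrite -map_mxM mulmxV// map_mx1.
have -> : char_poly_mx (T *m D *m invmx T) =
    map_mx polyC T *m char_poly_mx D *m map_mx polyC (invmx T).
  rewrite /char_poly_mx mulmxBr mulmxBl !map_mxM/=; congr (_ - _).
  by rewrite scalar_mxC -mulmxA TV mulmx1.
by rewrite !det_mulmx mulrAC -det_mulmx TV det1 mul1r.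
Qed.

(** [eigenvalue] concerns row vectors, while the error acts on columns; a row eigenvector of [A^T]
    transposes into a column eigenvector of A. *)
Lemma column_eigenvector (F : fieldType) (n : nat) (A : 'M[F]_n) (z : F) :
  root (char_poly A) z -> exists2 v : 'cV_n, A *m v = z *: v & v != 0.
Proof.
rewrite -char_poly_tr -eigenvalue_root_char => /eigenvalueP[v vA v0].
exists v^T; last by rewrite trmx_eq0.
by apply: trmx_inj; rewrite trmx_mul trmxK vA linearZ/= trmxK.
Qed.

(** * Pointwise error estimates and their integration *)

Definition scalar_error (R : realType) N (tau alpha : R) (z : R[i]) (t : R) :=
  cexp (z * t%:C) - \sum_(n < N.+1)
    s_coef n tau alpha z * (laguerre_fun tau alpha n t)%:C.

Lemma cmeasurable_scalar_error (R : realType) N (tau alpha : R) (z : R[i]) :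
  cmeasurable (scalar_error N tau alpha z).
Proof.
apply: cmeasurableB; first exact: cmeasurable_cderiv (cderiv_cexp z).
apply: cmeasurable_sum => n; apply: cmeasurableMl; apply: cmeasurable_real.
exact: measurable_laguerre_fun.
Qed.

Lemma measurable_sqr_frobenius_error (R : realType) (M : nat) (A : 'M[R[i]]_M)
    N (tau alpha : R) :
  measurable_fun setT
    (fun t => frobenius_norm (H_mx A t - HN_mx N tau alpha A t) ^+ 2).
Proof.
under eq_fun do rewrite sqr_frobenius_norm.
apply: measurable_sum => i; apply: measurable_sum => j.
apply: measurable_normc_sqr.
under eq_fun do rewrite mxE [X in _ + X]mxE summxE.
apply: cmeasurableB; first exact: cmeasurable_cderiv (cderiv_H_mx A i j).
under eq_fun do under eq_bigr do rewrite mxE mulrC.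
apply: cmeasurable_sum => n; apply: cmeasurableMl; apply: cmeasurable_real.
exact: measurable_laguerre_fun.
Qed.

Lemma zeta_le_sqr_error (R : realType) (M : nat) (A : 'M[R[i]]_M)
    (v : 'cV[R[i]]_M) (z : R[i]) N (tau alpha : R) :
  (forall i j, cbounded (fun t => H_mx A t i j)) -> Re z < 0 ->
  0 < tau -> -1 < alpha -> A *m v = z *: v -> v != 0 ->
  (zeta N tau alpha z <= \int[lebesgue_measure]_(t in `[0%R, +oo[)
     (frobenius_norm (H_mx A t - HN_mx N tau alpha A t)%R ^+ 2)%:E)%E.
Proof.
move=> HA z0 tau0 alpha1 Av v0; apply: ge0_le_integral => //.
- by move=> t _; rewrite lee_fin sqr_ge0.
- apply/measurable_EFinP; apply: measurable_funTS; apply: measurable_normc_sqr.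
  exact: cmeasurable_scalar_error.
- apply/measurable_EFinP; apply: measurable_funTS.
  exact: measurable_sqr_frobenius_error.
move=> t _; rewrite lee_fin ler_pXn2r ?nnegrE ?normc_ge0 ?frobenius_norm_ge0//.
(* The left side is |d_z(t)| |v|, and |v| > 0 cancels. *)
have := euclid_norm_mul_le (H_mx A t - HN_mx N tau alpha A t) v.
rewrite (error_eigenvector N t HA z0 tau0 alpha1 Av) euclid_normZ ler_pM2r//.
rewrite lt_neqAle euclid_norm_ge0 andbT eq_sym; apply: contra v0 => /eqP v0.
by apply/eqP; exact: euclid_norm_eq0.
Qed.

Lemma sqr_error_le_sum_zeta (R : realType) (M : nat) (A T D : 'M[R[i]]_M)
    N (tau alpha : R) :
  (forall i j, cbounded (fun t => H_mx A t i j)) ->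
  (forall k, Re (D k k) < 0) -> 0 < tau -> -1 < alpha ->
  T \in unitmx -> is_diag_mx D -> A = T *m D *m invmx T ->
  (\int[lebesgue_measure]_(t in `[0%R, +oo[)
     (frobenius_norm (H_mx A t - HN_mx N tau alpha A t)%R ^+ 2)%:E <=
   ((cond_num T) ^+ 2)%:E * \sum_(k < M) zeta N tau alpha (D k k))%E.
Proof.
move=> HA D0 tau0 alpha1 Tu Dd AE.
have mE z : measurable_fun (`[0, +oo[%classic : set R)
    (fun t => (Normc.normc (scalar_error N tau alpha z t) ^+ 2)%:E).
  apply/measurable_EFinP; apply: measurable_funTS; apply: measurable_normc_sqr.
  exact: cmeasurable_scalar_error.
(* The sum and the constant go under the integral, valid in [\bar R] by nonnegativity; it remains to
   compare integrands. *)
rewrite -ge0_integral_sum//; last 2 first.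
- by move=> k; exact: mE.
- by move=> k t _; rewrite lee_fin sqr_ge0.
rewrite -ge0_integralZl//; last 3 first.
- by apply: emeasurable_sum => k; exact: mE.
- by move=> t _; rewrite sume_ge0// => k _; rewrite lee_fin sqr_ge0.
- by rewrite lee_fin sqr_ge0.
apply: ge0_le_integral => //.
- by move=> t _; rewrite lee_fin sqr_ge0.
- apply/measurable_EFinP; apply: measurable_funTS.
  exact: measurable_sqr_frobenius_error.
- by apply: measurable_funeM; apply: emeasurable_sum => k; exact: mE.
move=> t _; rewrite sumEFin -EFinM lee_fin.
pose d : 'rV[R[i]]_M := \row_k scalar_error N tau alpha (D k k) t.
have AT k : A *m col k T = D k k *: col k T.
  have -> : A *m col k T = col k (T *m D).
    by rewrite AE !colE !mulmxA mulmxKV.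
  apply/colP => i; rewrite !mxE (bigD1 k)//= big1 ?addr0 1?mulrC// => j jk.
  by rewrite (is_diag_mxP Dd)// mulr0.
(* Column by column, this is the action of the error on the eigenvectors [col k T]. *)
have ET : (H_mx A t - HN_mx N tau alpha A t) *m T = T *m diag_mx d.
  apply/matrixP => i k.
  have := error_eigenvector N t HA (D0 k) tau0 alpha1 (AT k).
  move=> /(congr1 (fun u : 'cV_M => u i 0)).
  rewrite colE mulmxA -!colE mul_mx_diag !mxE => ->.
  by rewrite mulrC.
have -> : H_mx A t - HN_mx N tau alpha A t = T *m diag_mx d *m invmx T.
  by rewrite -ET mulmxK.
have -> : \sum_(k < M) Normc.normc (cexp (D k k * t%:C) - \sum_(n < N.+1)
    s_coef n tau alpha (D k k) * (laguerre_fun tau alpha n t)%:C) ^+ 2 =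
    frobenius_norm (diag_mx d) ^+ 2.
  by rewrite sqr_frobenius_norm_diag; apply: eq_bigr => k _; rewrite mxE.
rewrite -exprMn ler_pXn2r ?nnegrE ?mulr_ge0 ?frobenius_norm_ge0 ?op_norm_ge0//.
exact: frobenius_norm_conj_le.
Qed.

(** Both families list the roots of the same characteristic polynomial with multiplicity; the order
    along D may differ from that of [lambda]. *)
Lemma perm_diag_eigenvalues (R : realType) (M : nat) (A T D : 'M[R[i]]_M)
    (lambda : 'I_M -> R[i]) :
  char_poly A = \prod_(k < M) ('X - (lambda k)%:P) ->
  T \in unitmx -> is_diag_mx D -> A = T *m D *m invmx T ->
  perm_eq (codom (fun k => D k k)) (codom lambda).
Proof.
move=> lambdaE Tu Dd AE; apply: prod_XsubC_eq; rewrite !big_image/= -lambdaE.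
by rewrite AE char_poly_conj// char_poly_trig// is_diag_mx_is_trig.
Qed.

Lemma sqrte_le_mul (R : realType) (c : R) (x y : \bar R) :
  0 <= c -> (0 <= y)%E -> (x <= (c ^+ 2)%:E * y)%E ->
  (sqrte x <= c%:E * sqrte y)%E.
Proof.
move=> c0 y0 xy; have -> : c%:E = sqrte (c ^+ 2)%:E.
  by rewrite EFin_expe sqrte_sqr gee0_abs.
rewrite -sqrteM ?lee_fin ?sqr_ge0// lee_sqrt//.
by rewrite mule_ge0// lee_fin sqr_ge0.
Qed.

Theorem theorem4 (R : realType) (M : nat) (A : 'M[R[i]]_M)
    (lambda : 'I_M -> R[i]) (tau alpha : R) (N : nat)
    (M_gt0 : (0 < M)%N)
    (A_stable : stable_mx A)
    (lambdaE : char_poly A = \prod_(k < M) ('X - (lambda k)%:P))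
    (tau_gt0 : 0 < tau) (alpha_gtN1 : -1 < alpha) :
  (sqrte (\big[maxe/-oo]_(k < M) zeta N tau alpha (lambda k))
     <= L2_norm (fun t => H_mx A t - HN_mx N tau alpha A t)%R)%E
  /\
  (forall T D : 'M[R[i]]_M,
     T \in unitmx -> is_diag_mx D -> A = T *m D *m invmx T ->
     (L2_norm (fun t => H_mx A t - HN_mx N tau alpha A t)%R
        <= (cond_num T)%:E * sqrte (\sum_(k < M) zeta N tau alpha (lambda k)))%E
     /\
     ((cond_num T)%:E * sqrte (\sum_(k < M) zeta N tau alpha (lambda k))
        <= (cond_num T)%:E *
           sqrte (M%:R%:E *
                  \big[maxe/-oo]_(k < M) zeta N tau alpha (lambda k)))%E).
Proof.
have root_lambda k : root (char_poly A) (lambda k).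
  by rewrite lambdaE (bigD1 k)//= rootM root_XsubC eqxx.
have lambda0 k : Re (lambda k) < 0.
  by apply: A_stable; rewrite eigenvalue_root_char.
have HA := cbounded_H_mx lambdaE lambda0.
have zeta0 z : (0 <= zeta N tau alpha z)%E.
  by apply: integral_ge0 => t _; rewrite lee_fin sqr_ge0.
have zeta_max k : (zeta N tau alpha (lambda k) <=
    \big[maxe/-oo]_(k < M) zeta N tau alpha (lambda k))%E.
  exact: le_bigmax.
split.
  rewrite /L2_norm lee_sqrt; last first.
    by apply: integral_ge0 => t _; rewrite lee_fin sqr_ge0.
  (* Each zeta is bounded separately; the starting value -oo lies below everything. *)
  apply: bigmax_le => [|k _]; first exact: leNye.
  have [v Av v0] := column_eigenvector (root_lambda k).
  exact: zeta_le_sqr_error HA (lambda0 k) tau_gt0 alpha_gtN1 Av v0.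
move=> T D Tu Dd AE.
have cond0 : 0 <= cond_num T by rewrite mulr_ge0// op_norm_ge0.
have Dlambda := perm_diag_eigenvalues lambdaE Tu Dd AE.
have D0 k : Re (D k k) < 0.
  have : D k k \in codom lambda.
    by rewrite -(perm_mem Dlambda); exact: (codom_f (fun k => D k k)).
  by case/codomP => j ->.
have sum0 : (0 <= \sum_(k < M) zeta N tau alpha (lambda k))%E.
  by apply: sume_ge0.
split; last first.
  rewrite lee_wpmul2l ?lee_fin// lee_sqrt; last first.
    rewrite mule_ge0 ?lee_fin//.
    (* An empty maximum would be -oo; as M > 0, index 0 shows that it is nonnegative. *)
    exact: le_trans (zeta0 _) (zeta_max (Ordinal M_gt0)).
  apply: (@le_trans _ _ (\sum_(k < M)
      \big[maxe/-oo]_(k < M) zeta N tau alpha (lambda k))%E).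
    by apply: lee_sum => k _; exact: zeta_max.
  by rewrite sumr_const card_ord mule_natl.
(* The upper bound is proved with the diagonal of D, and the sum is insensitive to the order of the
   eigenvalues. *)
have sumE : (\sum_(k < M) zeta N tau alpha (D k k) =
    \sum_(k < M) zeta N tau alpha (lambda k))%E.
  transitivity (\sum_(z <- codom (fun k => D k k)) zeta N tau alpha z)%E.
    by rewrite big_image.
  by rewrite (perm_big _ Dlambda)/= big_image.
rewrite -sumE in sum0 *.
have := sqr_error_le_sum_zeta N HA D0 tau_gt0 alpha_gtN1 Tu Dd AE.
exact: sqrte_le_mul cond0 sum0.
Qed.
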